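(* Let $S$ be a finite nonempty set. A function $f:S^{\mathbb Z}\to S^{\mathbb Z}$ is a slider if and only if $f$ is a left-closing cellular automaton and $|\Psi_n|$ divides $|S|^n$ for $n=3m$, where $m$ is the smallest strong left-closing radius of $f$.
   Context: Configurations are elements $x\in S^{\mathbb Z}$ ($S$ finite), with the product topology; $\sigma(x)_i=x_{i+1}$ is the left shift. A cellular automaton (CA) is a continuous map $S^{\mathbb Z}\to S^{\mathbb Z}$ commuting with $\sigma$; $r$ is a neighborhood radius of $f$ if $f(x)_i$ depends only on $x_{[i-r,i+r]}$ (via a local rule independent of $i$). Intervals are intervals of integers. Block rules and sliders. A block rule is a function $\chi:S^m\to S^m$ ($m\ge1$). For $i\in\mathbb Z$, $\chi^i:S^{\mathbb Z}\to S^{\mathbb Z}$ applies $\chi$ at coordinate $i$: $\chi^i(x)_{[i,i+m)}=\chi(x_{[i,i+m)})$, and all other coordinates are unchanged. Define $\chi^{i+}(x)=\lim_{j\to\infty}\chi^{j}\circ\chi^{j-1}\circ\cdots\circ\chi^{i}(x)$ and, for a block rule $\xi$, $\xi^{i-}(x)=\lim_{j\to-\infty}\xi^{j}\circ\cdots\circ\xi^{i-2}\circ\xi^{i-1}(x)$; these limits always exist. If $\chi$ is bijective with inverse $\xi$, its slider relation is the set $F\subset S^{\mathbb Z}\times S^{\mathbb Z}$ of pairs $(y,z)$ such that for some $x\in S^{\mathbb Z}$ and $i\in\mathbb Z$, $\xi^{i-}(x)=y$ and $\chi^{i+}(x)=z$. A function $f$ is a slider (admits a slider) if it is (its graph is)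 the slider relation of some bijective block rule. Left-closing. A CA $f$ is left-closing if $f(y)\ne f(y')$ whenever $y\neq y'$ are configurations with $y_{[i,\infty)}=y'_{[i,\infty)}$ for some $i\in\mathbb Z$. For a left-closing CA $f$, a positive integer $m$ is a strong left-closing radius if $m\ge 2r$ for a neighborhood radius $r\ge1$ of $f$ and the following holds: whenever $s\in S^m$, $t\in S^{2m}$ are such that some $x\in S^{\mathbb Z}$ has $x_{(m,2m]}=s$ and $f(x)_{(0,2m]}=t$, then for all $b\in S$ there exists a unique $a\in S$ such that some $x\in S^{\mathbb Z}$ has $x_{[m,2m]}=as$ and $f(x)_{[0,2m]}=bt$. It is known that for a left-closing CA all sufficiently large $m$ are strong left-closing radii. Right stairs. For a CA $f$ and a positive integer $m$, $\Psi_{3m}$ is the set of pairs $(v,w)\in S^{2m}\times S^{2m}$ for which there exists $x\in S^{\mathbb Z}$ with $x_{[m,3m)}=v$ and $f(x)_{[0,2m)}=w$. *)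

(* Defs.v *)
From mathcomp Require Import all_boot all_order all_algebra.
From mathcomp Require Import all_classical topology.

Set Implicit Arguments.
Unset Strict Implicit.
Unset Printing Implicit Defensive.

Import Order.TTheory GRing.Theory Num.Theory.
Local Open Scope ring_scope.

(* S^Z with the product topology, S being discrete. *)
Definition config (S : finType) : Type := {ptws int -> discrete_topology S}.

Definition shift (S : finType) (x : config S) : config S :=
  fun i => x (i + 1).

(* The word x_[i, i + n). *)
Definition word (S : finType) (x : config S) (i : int) (n : nat) :
  n.-tuple S := [tuple x (i + k%:Z) | k < n].

Definition cellular_automaton (S : finType) (f : config S -> config S) : Prop :=
  continuous f /\ forall x, f (shift x) = shift (f x).

Definition neighborhood_radius (S : finType) (f : config S -> config S)
  (r : nat) : Prop :=
  exists rule : (2 * r).+1.-tuple S -> S,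
    forall (x : config S) (i : int), f x i = rule (word x (i - r%:Z) (2 * r).+1).

Definition block_rule (S : finType) (m : nat) : Type :=
  m.-tuple S -> m.-tuple S.

(* chi^i; the default value of nth is never reached. *)
Definition apply_at (S : finType) (m : nat) (chi : block_rule S m) (i : int)
  (x : config S) : config S :=
  fun j => if (i <= j) && (j < i + m%:Z)
           then nth (x j) (chi (word x i m)) `|j - i|%N
           else x j.

(* chi^{i+n-1} o ... o chi^{i+1} o chi^i *)
Fixpoint sweep_right (S : finType) (m : nat) (chi : block_rule S m) (i : int)
  (x : config S) (n : nat) : config S :=
  if n is n'.+1 then apply_at chi (i + n'%:Z) (sweep_right chi i x n') else x.

(* xi^{i-n} o ... o xi^{i-2} o xi^{i-1} *)
Fixpoint sweep_left (S : finType) (m : nat) (xi : block_rule S m) (i : int)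
  (x : config S) (n : nat) : config S :=
  if n is n'.+1 then apply_at xi (i - n%:Z) (sweep_left xi i x n') else x.

(* chi^{i+}(x) = z and xi^{i-}(x) = y, as limits in S^Z. *)
Definition right_limit (S : finType) (m : nat) (chi : block_rule S m)
  (i : int) (x z : config S) : Prop :=
  (sweep_right chi i x n @[n --> \oo] --> z)%classic.

Definition left_limit (S : finType) (m : nat) (xi : block_rule S m)
  (i : int) (x y : config S) : Prop :=
  (sweep_left xi i x n @[n --> \oo] --> y)%classic.

(* Slider relation of chi, where xi is meant to be the inverse of chi. *)
Definition slider_relation (S : finType) (m : nat) (chi xi : block_rule S m)
  (y z : config S) : Prop :=
  exists (x : config S) (i : int), left_limit xi i x y /\ right_limit chi i x z.

Definition slider (S : finType) (f : config S -> config S) : Prop :=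
  exists (m : nat) (chi xi : block_rule S m),
    [/\ (0 < m)%N, cancel chi xi, cancel xi chi &
        forall y z : config S, slider_relation chi xi y z <-> f y = z].

Definition left_closing (S : finType) (f : config S -> config S) : Prop :=
  forall y y' : config S, y <> y' ->
    (exists i : int, forall j : int, i <= j -> y j = y' j) -> f y <> f y'.

Definition strong_left_closing_radius (S : finType) (f : config S -> config S)
  (m : nat) : Prop :=
  [/\ (0 < m)%N,
      exists r : nat, [/\ (1 <= r)%N, neighborhood_radius f r & (2 * r <= m)%N] &
      forall (s : m.-tuple S) (t : (2 * m).-tuple S),
        (exists x : config S,
           word x (m%:Z + 1) m = s /\ word (f x) 1 (2 * m) = t) ->
        forall b : S, exists! a : S, exists x : config S,
          word x m%:Z m.+1 = [tuple of a :: s] /\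
          word (f x) 0 (2 * m).+1 = [tuple of b :: t]].

Definition smallest_strong_left_closing_radius (S : finType)
  (f : config S -> config S) (m : nat) : Prop :=
  strong_left_closing_radius f m /\
  forall m' : nat, strong_left_closing_radius f m' -> (m <= m')%N.

(* Right stairs: Psi f m is the set Psi_{3m}. *)
Definition Psi (S : finType) (f : config S -> config S) (m : nat) :
  {set (2 * m).-tuple S * (2 * m).-tuple S} :=
  finset (fun vw => `[< exists x : config S,
    word x m%:Z (2 * m) = vw.1 /\ word (f x) 0 (2 * m) = vw.2 >]).

(* Main.v *)
Require Import Defs.
From mathcomp Require Import all_boot all_order all_algebra.
From mathcomp Require Import all_classical topology.
From mathcomp Require Import fintype finset zify.

Set Implicit Arguments.
Unset Strict Implicit.
Unset Printing Implicit Defensive.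

Import Order.TTheory GRing.Theory Num.Theory.
Local Open Scope ring_scope.

(* A bijective block rule of length k + 1 is a reversible transducer: its state
   is a word of length k, and in each step it reads the next cell of the input
   and emits one cell of the output.  The slider relation consists of the pairs
   (input, output) of its bi-infinite runs.

   If: take the stairs, times an index below |S|^n / |Psi_n|, as states.  Reading
   one more cell shifts the stair and emits the cell of f(x) that drops out.
   The uniqueness in the strong left-closing property makes this step injective,
   hence bijective, because domain and codomain have the same size.

   Only if: since the output is a function of the input, it is determined once
   some number n of letters has been read, whatever the initial state.  From
   then on the set of possible states is mapped injectively, and comparing the
   words u and uv with v shows that its size is a constant c and that it
   depends on the last n letters only.  Two configurations that agree far to the right
   thus share a state there, from which equal outputs are traced back to equal
   inputs; this is left-closing.  For large m, the |S|^(3m) finite runs across a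
   window are grouped by stairs into classes of size c, so c |Psi_{3m}| =
   |S|^(3m).  Passing from a strong left-closing radius m to m + d multiplies
   |Psi_{3m}| by exactly |S|^(3d), which brings the identity down to the smallest m. *)

(** * Convergence and local rules *)

Lemma nbhs_coord (S : finType) (l : config S) (p : int) :
  nbhs l (fun x : config S => x p = l p).
Proof.
have := @proj_continuous int (fun=> discrete_topology S) p l.
by move=> /(_ [set l p]%classic); apply; exact: discrete_set1.
Qed.

Lemma cvg_configP (S : finType) (F : set_system (config S)) (l : config S) :
  Filter F -> (F --> l)%classic <-> forall p, F (fun x => x p = l p).
Proof.
move=> FF; split=> [Fl p|Fl]; first exact: Fl (nbhs_coord l p).
apply/cvg_sup => p U [V] [[W] oW <-] Wl WU.
by apply: (filterS WU); apply: filterS (Fl p) => x /= xp; rewrite /proj xp.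
Qed.

Lemma cvg_seq_configP (S : finType) (u : nat -> config S) (l : config S) :
  (u n @[n --> \oo] --> l)%classic <->
  forall p, exists N, forall n, (N <= n)%N -> u n p = l p.
Proof.
rewrite cvg_configP; split=> ul p; have := ul p.
  by case=> N _ uN; exists N => n; exact: uN.
by case=> N uN; exists N => // n; exact: uN.
Qed.

(** Locality without a rule table. Comparing two positions at once also makes the rule independent
    of the position, whence commutation with the shift. *)
Definition determined_within (S : finType) (f : config S -> config S)
    (r : nat) : Prop :=
  forall (x x' : config S) (i i' : int),
    (forall d : int, - r%:Z <= d <= r%:Z -> x (i + d) = x' (i' + d)) ->
    f x i = f x' i'.

Lemma eq_word (S : finType) (x x' : config S) (i i' : int) (n : nat) :
  word x i n = word x' i' n <->
  forall k, (k < n)%N -> x (i + k%:Z) = x' (i' + k%:Z).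
Proof.
split=> [eqxx' k kn|eqxx']; last by apply: eq_mktuple => k; exact: eqxx'.
by have /(congr1 (fun w => tnth w (Ordinal kn))) := eqxx'; rewrite !tnth_mktuple.
Qed.

Lemma neighborhood_radiusP (S : finType) (f : config S -> config S) (r : nat) :
  neighborhood_radius f r <-> determined_within f r.
Proof.
split=> [[rule fE] x x' i i' eqxx'|fr].
  rewrite !fE; congr rule; apply/eq_word => k kr.
  by rewrite -!addrA ![- _ + _]addrC; apply: eqxx'; lia.
(* Over an empty alphabet there are no configurations, and any function on words serves as rule,
   here [thead]. *)
have [s0|noS] := pselect (exists s : S, True); last first.
  have [rule] : exists rule : (2 * r).+1.-tuple S -> S, True.
    by exists (fun w => thead w).
  by exists rule => x; case: noS; exists (x 0).
have {s0} [s0 _] := s0.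
exists (fun w => f (fun j : int => nth s0 w (absz (j + r%:Z))) 0) => x i.
apply: fr => d dr.
have kr : (absz (d + r%:Z)%R < (2 * r).+1)%N by lia.
rewrite add0r -(tnth_nth s0 _ (Ordinal kr)) tnth_mktuple /=.
by congr x; lia.
Qed.

Lemma determined_within_continuous (S : finType) (f : config S -> config S) r :
  determined_within f r -> continuous f.
Proof.
move=> fr x; have FF := fmap_filter f (nbhs_filter x).
apply/cvg_configP => p.
have nbhs_agree (n : nat) :
    nbhs x (fun y : config S => forall k, (k < n)%N ->
                            y (p - r%:Z + k%:Z) = x (p - r%:Z + k%:Z)).
  elim: n => [|n IHn]; first exact: filterE.
  apply: filterS2 IHn (nbhs_coord x (p - r%:Z + n%:Z)) => y IHy yn k.
  rewrite ltnS leq_eqVlt => /orP[/eqP->//|].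
  exact: IHy.
apply: filterS (nbhs_agree (2 * r).+1) => y yx; apply: fr => d dr.
have := yx (absz (d + r%:Z)).
by have -> : p - r%:Z + (absz (d + r%:Z))%:Z = p + d; [lia | apply; lia].
Qed.

Lemma determined_within_shift (S : finType) (f : config S -> config S) r x :
  determined_within f r -> f (shift x) = shift (f x).
Proof.
by move=> fr; apply/funext => i; apply: fr => d _; rewrite /shift; congr x; lia.
Qed.

(** * Transducers *)

Section Transducers.
Variables (Q S : finType) (T : Q * S -> S * Q) (U : S * Q -> Q * S).

Definition run (rho : int -> Q) (y z : int -> S) : Prop :=
  forall i : int, T (rho i, y i) = (z i, rho (i + 1)).

Lemma run_shift (d : int) rho y z : run rho y z ->
  run (fun i => rho (i + d)) (fun i => y (i + d)) (fun i => z (i + d)).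
Proof. by move=> runR i; rewrite runR addrAC. Qed.

(** [Negz n] is time -(n+1), so [g n] is the state at time -n and [a n] the letter read at time
    -(n+1). From time 0 on, [y] drives the run. *)
Lemma run_of_past (g : nat -> Q) (a : nat -> S) (y : int -> S) :
  (forall n, (T (g n.+1, a n)).2 = g n) ->
  exists rho y' z, [/\ run rho y' z, rho 0 = g 0%N,
    forall n, rho (Negz n) = g n.+1 /\ y' (Negz n) = a n &
    forall n : nat, y' n%:Z = y n%:Z].
Proof.
move=> ga.
pose h := fix h (n : nat) := if n is n'.+1 then (T (h n', y n'%:Z)).2 else g 0%N.
pose rho i := match i with Posz n => h n | Negz n => g n.+1 end.
pose y' i := match i with Posz n => y n%:Z | Negz n => a n end.
exists rho, y', (fun i => (T (rho i, y' i)).1); split=> // i.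
rewrite [LHS]surjective_pairing; congr pair.
case: i => [n|[|n]]; first by rewrite addrC.
  by rewrite /= ga.
by rewrite [_ + 1](_ : _ = Negz n) /= ?ga //; lia.
Qed.

Hypotheses (TK : cancel T U) (UK : cancel U T).

(** From one state, [T] generates the future by reading inputs and [U] the past by taking back
    outputs, so state, future input and past output can be prescribed independently. *)
Lemma run_through (q : Q) (i : int) (y z : int -> S) :
  exists rho y' z', [/\ run rho y' z', rho i = q,
    forall j, i <= j -> y' j = y j & forall j, j < i -> z' j = z j].
Proof.
pose g := fix g (n : nat) := if n is n'.+1 then (U (z (i + Negz n'), g n')).1 else q.
have ga n : (g n.+1, (U (z (i + Negz n), g n)).2) = U (z (i + Negz n), g n).
  by rewrite [RHS]surjective_pairing.
have [|rho [y' [z' [runR rho0 pastE y'P]]]] := @run_of_past g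
    (fun n => (U (z (i + Negz n), g n)).2) (fun j => y (i + j)).
  by move=> n; rewrite ga UK.
have z'N n : z' (Negz n) = z (i + Negz n).
  have [rhoN y'N] := pastE n.
  by have := runR (Negz n); rewrite rhoN y'N ga UK => -[].
exists (fun j => rho (j - i)), (fun j => y' (j - i)), (fun j => z' (j - i)).
split=> [||j ij|j ji]; first exact: run_shift.
- by rewrite subrr.
- by rewrite (_ : j - i = `|j - i|%N) ?y'P ?absz_nat; [congr y; lia | lia].
- by rewrite (_ : j - i = Negz `|j - i|.-1) ?z'N; [congr z; lia | lia].
Qed.

Lemma run_forward rho y z rho' y' z' (a : int) : run rho y z -> run rho' y' z' ->
  rho a = rho' a -> forall n : nat,
  (forall j, a <= j < a + n%:Z -> y j = y' j) ->
  rho (a + n%:Z) = rho' (a + n%:Z) /\ forall j, a <= j < a + n%:Z -> z j = z' j.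
Proof.
move=> runR runR' rhoa; elim=> [|n IHn] eqyy'; first by rewrite addr0; split=> // j; lia.
have [|rhon eqzz'] := IHn; first by move=> j jn; apply: eqyy'; lia.
have := runR (a + n%:Z); rewrite eqyy'; last lia.
rewrite rhon runR' => -[zn rhoSn]; split=> [|j jn].
  by rewrite -addn1 PoszD addrA.
have [->//|jNn] := eqVneq j (a + n%:Z); apply: eqzz'; lia.
Qed.

Lemma run_backward rho y z rho' y' z' (b : int) : run rho y z -> run rho' y' z' ->
  rho b = rho' b -> forall n : nat,
  (forall j, b - n%:Z <= j < b -> z j = z' j) ->
  rho (b - n%:Z) = rho' (b - n%:Z) /\ forall j, b - n%:Z <= j < b -> y j = y' j.
Proof.
move=> runR runR' rhob; elim=> [|n IHn] eqzz'; first by rewrite subr0; split=> // j; lia.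
have [|rhon eqyy'] := IHn; first by move=> j jn; apply: eqzz'; lia.
have := runR (b - n.+1%:Z); rewrite eqzz'; last lia.
have -> : b - n.+1%:Z + 1 = b - n%:Z by lia.
rewrite rhon (_ : rho' _ = rho' (b - n.+1%:Z + 1)); last by congr rho'; lia.
rewrite -runR' => /(can_inj TK) [rhoSn yn]; split=> // j jn.
have [->//|jNn] := eqVneq j (b - n.+1%:Z); apply: eqyy'; lia.
Qed.

Definition functional_runs : Prop := forall rho y z rho' y' z',
  run rho y z -> run rho' y' z' -> (forall j, y j = y' j) -> forall j, z j = z' j.

Definition next (q : Q) (a : S) : Q := (T (q, a)).2.

(* The set of pairs of states reached by reading a common word of length [l]
   shrinks as [l] grows, down to a set in which every pair has a predecessor.
   A pair in that set lies on two runs with the same input, so it cannot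
   produce different outputs. *)
Lemma functional_runs_memory : functional_runs ->
  exists n, forall q q' (u : seq S) (a : S), (n <= size u)%N ->
    (T (foldl next q u, a)).1 = (T (foldl next q' u, a)).1.
Proof.
move=> funR.
pose P (X : {set Q * Q}) : {set Q * Q} :=
  [set (next pa.1.1 pa.2, next pa.1.2 pa.2) | pa in setX X [set: S]].
have P_mono : {homo P : X Y / X \subset Y}.
  by move=> X Y XY; apply/imsetS/setXS.
(* [cofixset] is what [n] iterations leave of the full set: a decreasing chain of sets of pairs is
   stationary by then. *)
pose n := #|{: Q * Q}|.
have iterPn : iter n P setT = cofixset P.
  rewrite /cofixset /fixset -/n; elim: n => [|n IHn]; first by rewrite setC0.
  by rewrite !iterS IHn /funsetC !setCK.
have iterP k : iter (k + n) P setT = cofixset P.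
  by rewrite iterD iterPn; elim: k => //= k ->; exact: cofixsetK.
have foldl_iter q q' u : (foldl next q u, foldl next q' u) \in iter (size u) P setT.
  elim/last_ind: u => [|u a IHu]; first by rewrite inE.
  rewrite size_rcons !foldl_rcons iterS; apply/imsetP.
  by exists ((foldl next q u, foldl next q' u), a); rewrite // in_setX IHu inE.
exists n => q q' u a nu.
have := foldl_iter q q' u; rewrite -(subnK nu) iterP.
move: (foldl next q u) (foldl next q' u) => {q q' u nu} q q' qq'C.
(* Each pair of the limit set gets a predecessor pair in it and the common letter read in between;
   other pairs get a dummy. *)
have /choice[pre preP] (p : Q * Q) : exists pa : (Q * Q) * S, p \in cofixset P ->
    pa.1 \in cofixset P /\ p = (next pa.1.1 pa.2, next pa.1.2 pa.2).
  have [pC|pNC] := boolP (p \in cofixset P); last by exists (p, a).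
  move: pC; rewrite -{1}cofixsetK // => /imsetP[[p0 b]]; rewrite in_setX => /andP[p0C _] ->.
  by exists (p0, b).
pose g k := iter k (fun p => (pre p).1) (q, q').
have gC k : g k \in cofixset P.
  by elim: k => //= k /preP[].
have gE k : g k = (next (g k.+1).1 (pre (g k)).2, next (g k.+1).2 (pre (g k)).2).
  by have [_ {1}->] := preP _ (gC k).
have [|rho [y [z [runR rho0 pastR yP]]]] := @run_of_past (fun k => (g k).1)
    (fun k => (pre (g k)).2) (fun=> a).
  by move=> k; rewrite [g k in RHS]gE.
have [|rho' [y' [z' [runR' rho'0 pastR' yP']]]] := @run_of_past (fun k => (g k).2)
    (fun k => (pre (g k)).2) (fun=> a).
  by move=> k; rewrite [g k in RHS]gE.
have := funR _ _ _ _ _ _ runR runR' _ 0.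
move: (runR 0) (runR' 0); rewrite yP yP' rho0 rho'0 => -> ->; apply.
case=> k; first by rewrite yP yP'.
by have [_ ->] := pastR k; have [_ ->] := pastR' k.
Qed.

(** * Sets of states reachable by reading a word *)

Definition reach (u : seq S) : {set Q} := [set foldl next q u | q in [set: Q]].

Lemma reach_cat u v : reach (u ++ v) \subset reach v.
Proof.
apply/subsetP => q /imsetP[q0 _ ->]; rewrite foldl_cat.
exact: imset_f (in_setT _).
Qed.

Lemma reach_rcons u a : reach (rcons u a) = [set next q a | q in reach u].
Proof.
by rewrite /reach -imset_comp; apply: eq_imset => q; rewrite /= foldl_rcons.
Qed.

Section Memory.
Variable n : nat.
Hypothesis memory : forall q q' (u : seq S) (a : S), (n <= size u)%N ->
  (T (foldl next q u, a)).1 = (T (foldl next q' u, a)).1.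

Lemma reach_output u a q q' : (n <= size u)%N -> q \in reach u -> q' \in reach u ->
  (T (q, a)).1 = (T (q', a)).1.
Proof. by move=> nu /imsetP[q0 _ ->] /imsetP[q0' _ ->]; exact: memory. Qed.

(** Past the memory length all states of [reach u] emit the same letter, so injectivity of [T]
    passes to the next state alone. *)
Lemma card_reach_rcons u a : (n <= size u)%N -> #|reach (rcons u a)| = #|reach u|.
Proof.
move=> nu; rewrite reach_rcons card_in_imset // => q q' qu q'u nextqq'.
suff [] : (q, a) = (q', a) by [].
apply: (can_inj TK); rewrite [LHS]surjective_pairing [RHS]surjective_pairing.
by congr pair; first exact: reach_output qu q'u.
Qed.

(** Reading [v] after [u] keeps the size of [reach u] and lands inside [reach v]; symmetry gives the
    other inequality. *)
Lemma card_reach u v : (n <= size u)%N -> (n <= size v)%N -> #|reach u| = #|reach v|.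
Proof.
wlog suff le_uv : u v / (n <= size u)%N -> (n <= size v)%N -> (#|reach u| <= #|reach v|)%N.
  by move=> nu nv; apply/eqP; rewrite eqn_leq !le_uv.
move=> nu nv; apply: leq_trans (subset_leq_card (reach_cat u v)).
elim/last_ind: v {nv} => [|v a IHv]; first by rewrite cats0.
by rewrite -rcons_cat card_reach_rcons // size_cat (leq_trans nu) ?leq_addr.
Qed.

Lemma reach_catr u v : (n <= size v)%N -> reach (u ++ v) = reach v.
Proof.
move=> nv; apply/eqP; rewrite eqEcard reach_cat (@card_reach v (u ++ v)) //=.
by rewrite size_cat (leq_trans nv) ?leq_addl.
Qed.

Definition window (y : int -> S) (i : int) : seq S :=
  mkseq (fun k => y (i - n%:Z + k%:Z)) n.

Lemma window_next (y : int -> S) (i : int) :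
  exists a, a :: window y (i + 1) = rcons (window y i) (y i).
Proof.
rewrite /window; exists (y (i - n%:Z)); apply: (@eq_from_nth _ (y 0)) => [|k].
  by rewrite /= size_rcons !size_mkseq.
rewrite /= size_mkseq nth_rcons size_mkseq ltnS leq_eqVlt => /orP[/eqP->|kn].
  rewrite ltnn eqxx; case: n => [|m] /=; first by rewrite subr0.
  by rewrite nth_mkseq //; congr y; lia.
rewrite kn nth_mkseq //; case: k kn => [|k] kn /=; first by congr y; lia.
by rewrite nth_mkseq; [congr y; lia | exact: ltnW].
Qed.

Lemma reach_window_next (y : int -> S) (i : int) :
  reach (window y (i + 1)) = [set next q (y i) | q in reach (window y i)].
Proof.
have [a eqa] := window_next y i.
by rewrite -reach_rcons -eqa -cat1s reach_catr // size_mkseq.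
Qed.

Lemma run_reach rho y z i : run rho y z -> rho i \in reach (window y i).
Proof.
move=> runR; suff foldlE b k :
    foldl next (rho b) (mkseq (fun k => y (b + k%:Z)) k) = rho (b + k%:Z).
  have -> : rho i = rho (i - n%:Z + n%:Z) by congr rho; lia.
  by rewrite -foldlE; exact: imset_f (in_setT _).
elim: k => [|k IHk]; first by rewrite addr0.
rewrite mkseqS foldl_rcons IHk /next runR /=; congr rho; lia.
Qed.

Hypothesis total : forall y : int -> S, exists rho z, run rho y z.

(** Converse of [run_reach]. Give the run through [q] the past output of some run on [y]. Going back
    step by step, its state has a predecessor reachable on [y], which emits that same output; as [T]
    is injective, the run comes from there and has input [y]. *)
Lemma reach_run (y : int -> S) (i : int) (q : Q) :
  q \in reach (window y i) -> exists rho z, run rho y z /\ rho i = q.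
Proof.
move=> qi; have [rho0 [z0 run0]] := total y.
have [rho [y' [z [runR rhoi y'P zP]]]] := run_through q i y z0.
suff back k : rho (i - k%:Z) \in reach (window y (i - k%:Z)) /\
    forall j, i - k%:Z <= j -> y' j = y j.
  exists rho, z; split=> // j; have [_ y'y] := back (absz (i - j)).
  by rewrite -y'y; [exact: runR | lia].
elim: k => [|k [rhok y'y]]; first by rewrite subr0 rhoi.
have eqi : i - k%:Z = i - k.+1%:Z + 1 by lia.
move: rhok; rewrite eqi reach_window_next => /imsetP[p pk rhoE].
suff /(can_inj TK) [-> yk] : T (rho (i - k.+1%:Z), y' (i - k.+1%:Z)) = T (p, y (i - k.+1%:Z)).
  split=> // j jk; have [->//|jNk] := eqVneq j (i - k.+1%:Z).
  by apply: y'y; lia.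
rewrite runR rhoE zP; last lia.
rewrite [RHS]surjective_pairing; congr pair.
have := reach_output (y (i - k.+1%:Z)) _ pk (run_reach _ run0).
by rewrite run0 => ->; rewrite // size_mkseq.
Qed.

End Memory.
End Transducers.

(** * Sliders as transducers *)

Lemma nth_word (S : finType) (s : S) (x : config S) (i : int) (n j : nat) :
  (j < n)%N -> nth s (word x i n) j = x (i + j%:Z).
Proof. by move=> jn; rewrite (nth_mktuple _ _ (Ordinal jn)). Qed.

Section Blocks.
Variables (S : finType) (k : nat).

Definition join_head (p : S * k.-tuple S) : k.+1.-tuple S := [tuple of p.1 :: p.2].
Definition split_head (w : k.+1.-tuple S) : S * k.-tuple S :=
  (thead w, [tuple of behead w]).
Definition join_last (p : k.-tuple S * S) : k.+1.-tuple S := [tuple of rcons p.1 p.2].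
Definition split_last (w : k.+1.-tuple S) : k.-tuple S * S :=
  ([tuple of belast (thead w) (behead w)], last (thead w) (behead w)).

Lemma join_headK : cancel join_head split_head.
Proof. by case=> a q; congr pair; exact: val_inj. Qed.

Lemma split_headK : cancel split_head join_head.
Proof. by move=> w; rewrite [RHS]tuple_eta; exact: val_inj. Qed.

Lemma split_lastK : cancel split_last join_last.
Proof.
by move=> w; apply: val_inj; rewrite /= -lastI [in RHS](tuple_eta w).
Qed.

Lemma join_lastK : cancel join_last split_last.
Proof.
move=> [q a]; have /(congr1 val)/= := split_lastK (join_last (q, a)).
by move=> /rcons_inj[eqq eqa]; rewrite -[RHS]/(q, a); congr pair; first exact: val_inj.
Qed.

Lemma word_join_head (x : config S) (i : int) :
  word x i k.+1 = join_head (x i, word x (i + 1) k).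
Proof.
apply: val_inj; apply: (@eq_from_nth _ (x 0)); rewrite ?size_tuple //= => -[|j] jk.
  by rewrite nth_word // addr0.
by rewrite nth_word //= nth_word //; congr x; lia.
Qed.

Lemma word_cons (x : config S) (i : int) (a : S) (s : k.-tuple S) :
  word x i k.+1 = [tuple of a :: s] <-> x i = a /\ word x (i + 1) k = s.
Proof.
rewrite word_join_head -[X in _ = X]/(join_head (a, s)).
by split=> [/(can_inj join_headK)/pair_equal_spec|[-> ->]].
Qed.

Lemma word_join_last (x : config S) (i : int) :
  word x i k.+1 = join_last (word x i k, x (i + k%:Z)).
Proof.
apply: val_inj; apply: (@eq_from_nth _ (x 0)); rewrite ?size_tuple // => j jk.
rewrite nth_word // -[val (join_last _)]/(rcons (word x i k) (x (i + k%:Z))).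
rewrite nth_rcons size_tuple.
case: (ssrnat.ltngtP j k) => [jltk|kltj|->//]; first by rewrite nth_word.
by move: jk; rewrite ltnS leqNgt kltj.
Qed.

End Blocks.

Section Sweeps.
Variables (S : finType) (m : nat) (chi : block_rule S m).

Lemma apply_at_out (i j : int) (x : config S) : ~~ (i <= j < i + m%:Z) ->
  apply_at chi i x j = x j.
Proof. by rewrite /apply_at => /negPf ->. Qed.

Lemma apply_atP (i : int) (x x' : config S) : x' = apply_at chi i x <->
  word x' i m = chi (word x i m) /\ forall j, ~~ (i <= j < i + m%:Z) -> x' j = x j.
Proof.
have apply_at_in (l : 'I_m) : apply_at chi i x (i + l%:Z) = tnth (chi (word x i m)) l.
  rewrite /apply_at ifT; last by have := ltn_ord l; lia.
  by rewrite (tnth_nth (x (i + l%:Z))); congr nth; lia.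
split=> [->|[wordx' x'E]].
  split=> [|j]; last exact: apply_at_out.
  by apply: eq_from_tnth => l; rewrite tnth_mktuple apply_at_in.
apply/funext => j; have [ijm|] := boolP (i <= j < i + m%:Z); last first.
  by move=> jout; rewrite x'E // apply_at_out.
have jm : (absz (j - i)%R < m)%N by lia.
rewrite (_ : j = i + (Ordinal jm)%:Z); last by rewrite /=; lia.
by rewrite apply_at_in -wordx' tnth_mktuple.
Qed.

End Sweeps.

Lemma apply_atK (S : finType) (m : nat) (chi xi : block_rule S m) (i : int) :
  cancel chi xi -> cancel (apply_at chi i) (apply_at xi i).
Proof.
move=> chiK x; apply/esym/apply_atP; split=> [|j jout]; last by rewrite apply_at_out.
by have [-> _] := (apply_atP chi i x _).1 erefl; rewrite chiK.
Qed.

(** * Sweeps of a block rule as bi-infinite orbits *)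

Section Slides.
Variables (S : finType) (k : nat) (chi xi : block_rule S k.+1).
Hypotheses (chiK : cancel chi xi) (xiK : cancel xi chi).

Definition slide (X : int -> config S) : Prop :=
  forall j, X (j + 1) = apply_at chi j (X j).

(** Only the applications at positions [p - k] to [p] touch cell [p]: up to them it holds its input
    value, after them its output value. *)
Lemma slide_left X : slide X -> forall p j, j <= p - k%:Z -> X j p = X (p - k%:Z) p.
Proof.
move=> XE p j jp; have -> : j = p - k%:Z - (absz (p - k%:Z - j)%R)%:Z by lia.
elim: (absz _) => [|n IHn]; first by rewrite subr0.
rewrite -IHn (_ : _ - n%:Z = p - k%:Z - n.+1%:Z + 1); last lia.
by rewrite XE apply_at_out //; lia.
Qed.

Lemma slide_right X : slide X -> forall p j, p < j -> X j p = X (p + 1) p.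
Proof.
move=> XE p j pj; have -> : j = p + 1 + (absz (j - (p + 1))%R)%:Z by lia.
elim: (absz _) => [|n IHn]; first by rewrite addr0.
rewrite -IHn (_ : _ + n.+1%:Z = p + 1 + n%:Z + 1); last lia.
by rewrite XE apply_at_out //; lia.
Qed.

Lemma slide_sweep_right X n : slide X -> sweep_right chi 0 (X 0) n = X n%:Z.
Proof. by move=> XE; elim: n => //= n ->; rewrite add0r -XE; congr X; lia. Qed.

Lemma slide_sweep_left X n : slide X -> sweep_left xi 0 (X 0) n = X (- n%:Z).
Proof.
move=> XE; elim: n => [|n IHn] //=; rewrite IHn sub0r -[RHS](apply_atK (- n.+1%:Z) chiK).
by rewrite -XE; congr apply_at; congr X; lia.
Qed.

(** By [slide_left] and [slide_right] each cell of a sweep is eventually constant, which removes the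
    limits. As [xi] undoes [chi], the two sweeps from [x] are the halves of one orbit. *)
Lemma slider_relation_slide (y z : config S) : slider_relation chi xi y z <->
  exists X, [/\ slide X, forall p, y p = X (p - k%:Z) p & forall p, z p = X (p + 1) p].
Proof.
split=> [[x [i [/cvg_seq_configP yP /cvg_seq_configP zP]]]|[X [XE yE zE]]]; last first.
  exists (X 0), 0; split; apply/cvg_seq_configP => p.
    exists (absz (p - k%:Z)%R) => n np.
    by rewrite slide_sweep_left // slide_left ?yE //; lia.
  exists (absz (p + 1)%R) => n np.
  by rewrite slide_sweep_right // slide_right ?zE //; lia.
pose X j := if i <= j then sweep_right chi i x (absz (j - i)%R)
            else sweep_left xi i x (absz (i - j)%R).
have XR n : X (i + n%:Z) = sweep_right chi i x n.
  by rewrite /X ifT; [congr sweep_right; lia | lia].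
have XL n : X (i - n%:Z) = sweep_left xi i x n.
  case: n => [|n]; first by rewrite subr0 -[i]addr0 XR.
  by rewrite /X ifF; [congr sweep_left; lia | lia].
have XE : slide X.
  move=> j; have [ij|ji] := lerP i j.
    have -> : j = i + (absz (j - i)%R)%:Z by lia.
    rewrite XR -[RHS]/(sweep_right chi i x (absz (j - i)%R).+1) -XR; congr X; lia.
  rewrite (_ : j + 1 = i - (absz (i - j)%R).-1%:Z) ?XL; last lia.
  rewrite (_ : X j = X (i - (absz (i - j)%R).-1.+1%:Z)); last by congr X; lia.
  rewrite XL /= (_ : i - (absz (i - j)%R).-1.+1%:Z = j); last lia.
  by rewrite (apply_atK _ xiK).
exists X; split=> // p.
  have [N yN] := yP p; rewrite -(yN (N + absz (i - (p - k%:Z))%R)%N) ?leq_addr //.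
  by rewrite -XL slide_left //; lia.
have [N zN] := zP p; rewrite -(zN (N + absz (p + 1 - i)%R)%N) ?leq_addr //.
by rewrite -XR slide_right //; lia.
Qed.

Definition block_step (qa : k.-tuple S * S) : S * k.-tuple S :=
  split_head (chi (join_last qa)).

(* The state at time [i] fills the cells [i, i + k), hence the shift of the input by [k]. *)
Lemma slider_relation_run (y z : config S) : slider_relation chi xi y z <->
  exists rho, run block_step rho (fun i => y (i + k%:Z)) z.
Proof.
rewrite slider_relation_slide; split=> [[X [XE yE zE]]|[rho rhoR]].
  exists (fun j => word (X j) j k) => j.
  have [wordX _] := (apply_atP chi j (X j) (X (j + 1))).1 (XE j).
  rewrite /block_step yE addrK -word_join_last -wordX word_join_head join_headK.
  by rewrite zE.
(* Output before [j], the state on [j, j + k), input from [j + k] on; there [nth] runs past the end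
   of the state and returns its default [y p]. *)
pose X j : config S := fun p => if p < j then z p else
  nth (y p) (rho j) (absz (p - j)%R).
have Xy j p : j + k%:Z <= p -> X j p = y p.
  by move=> jp; rewrite /X ifF ?nth_default ?size_tuple //; lia.
have Xz j p : p < j -> X j p = z p by rewrite /X => ->.
have wordX j : word (X j) j k = rho j.
  apply: eq_from_tnth => l; rewrite tnth_mktuple /X ifF; last lia.
  by rewrite (tnth_nth (y (j + l%:Z))); congr nth; lia.
exists X; split=> [j|p|p]; last 2 first.
- by rewrite Xy //; lia.
- by rewrite Xz //; lia.
apply/apply_atP; split=> [|p pout]; last first.
  by have [pj|jp] := ltP p j; [rewrite !Xz //; lia | rewrite !Xy //; lia].
rewrite word_join_head word_join_last !wordX (Xy j) // (Xz _ j); last lia.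
by have := rhoR j; rewrite /block_step => rhoj; rewrite -[RHS]split_headK rhoj.
Qed.

End Slides.

(** * Stairs *)

Lemma eq_card_bij (A B : finType) : #|A| = #|B| ->
  exists (g : A -> B) (h : B -> A), cancel g h /\ cancel h g.
Proof.
move=> eqAB; exists (fun a => enum_val (cast_ord eqAB (enum_rank a))).
exists (fun b => enum_val (cast_ord (esym eqAB) (enum_rank b))).
by split=> c; rewrite enum_valK ?cast_ordK ?cast_ordKV enum_rankK.
Qed.

(** The states can be renamed as the words of length [k]; the transducer is then [block_step] of a
    bijective block rule of length [k + 1]. *)
Lemma transducer_slider (S Q : finType) (k : nat) (T : Q * S -> S * Q)
    (f : config S -> config S) :
  injective T -> #|Q| = (#|S| ^ k)%N ->
  (forall y z, (exists rho, run T rho (fun i => y (i + k%:Z)) z) <-> f y = z) ->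
  slider f.
Proof.
move=> T_inj cardQ fP; rewrite -card_tuple in cardQ.
have [e [e' [eK e'K]]] := eq_card_bij cardQ.
pose T' (qa : k.-tuple S * S) := ((T (e' qa.1, qa.2)).1, e (T (e' qa.1, qa.2)).2).
pose chi (w : k.+1.-tuple S) := join_head (T' (split_last w)).
have chi_inj : injective chi.
  apply: inj_comp (can_inj (@join_headK _ _)) _.
  apply: inj_comp (can_inj (@split_lastK _ _)) => -[q a] [q' a'] [eqb /(can_inj eK) eqp].
  have /T_inj [/(can_inj e'K) -> -> //] : T (e' q, a) = T (e' q', a').
  by rewrite [LHS]surjective_pairing [RHS]surjective_pairing /= eqb eqp.
have stepE : block_step chi =1 T' by move=> p; rewrite /block_step join_headK join_lastK.
have chiK : cancel chi (invF chi_inj) by exact: invF_f.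
have xiK : cancel (invF chi_inj) chi by exact: f_invF.
exists k.+1, chi, (invF chi_inj); split=> // y z.
rewrite slider_relation_run // -fP; split=> -[rho rhoR].
  exists (fun i => e' (rho i)) => i; have := rhoR i; rewrite stepE => -[<- <-].
  by rewrite eK [LHS]surjective_pairing.
exists (fun i => e (rho i)) => i; rewrite stepE /T' eK.
by rewrite rhoR.
Qed.

Section Stairs.
Variables (S : finType) (f : config S -> config S) (m : nat).

Lemma stair_subproof (y : config S) :
  (word y m%:Z (2 * m), word (f y) 0 (2 * m)) \in Psi f m.
Proof. by rewrite inE; apply/asboolP; exists y. Qed.

Definition stair (y : config S) : {p | p \in Psi f m} :=
  exist (fun p => p \in Psi f m) _ (stair_subproof y).

Lemma eq_stair (y y' : config S) : stair y = stair y' <->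
  (forall j, m%:Z <= j < (3 * m)%:Z -> y j = y' j) /\
  (forall j, 0 <= j < (2 * m)%:Z -> f y j = f y' j).
Proof.
split=> [/(congr1 val)/pair_equal_spec[/eq_word eqyy' /eq_word eqff']|[eqyy' eqff']]; last first.
  apply: val_inj; congr pair; apply/eq_word => j jm; [apply: eqyy' | apply: eqff']; lia.
split=> j jm.
  by have := eqyy' (absz (j - m%:Z)%R); rewrite (_ : m%:Z + _ = j); [apply | ]; lia.
by have := eqff' (absz j); rewrite (_ : 0 + _ = j); [apply | ]; lia.
Qed.

Lemma stair_surj p : exists y, stair y = p.
Proof.
case: p => p pPsi; have := pPsi; rewrite inE => /asboolP[y [yp fyp]].
by exists y; apply: val_inj; rewrite /= yp fyp; case: (p).
Qed.

Variable r : nat.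
Hypotheses (r_gt0 : (0 < r)%N) (fr : determined_within f r) (rm : (2 * r <= m)%N).

(** The values of [f] on [0, 2m) depend only on cells below [3m], so cell [3m] is free. *)
Lemma stair_extend p (a : S) : exists y, stair y = p /\ y (3 * m)%:Z = a.
Proof.
have [y <-] := stair_surj p.
exists (fun j => if j == (3 * m)%:Z then a else y j); rewrite eqxx; split=> //.
apply/eq_stair; split=> j jm; first by rewrite ifF //; lia.
by apply: fr => d dr; rewrite ifF //; lia.
Qed.

Lemma stair_shift (y y' : config S) : stair y = stair y' ->
  y (3 * m)%:Z = y' (3 * m)%:Z -> stair (shift y) = stair (shift y').
Proof.
move=> /eq_stair[eqyy' eqff'] eq3m; apply/eq_stair.
have {eq3m} eqyy' j : m%:Z <= j < (3 * m)%:Z + 1 -> y j = y' j.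
  by have [-> //|jN] := eqVneq j (3 * m)%:Z => jm; apply: eqyy'; lia.
split=> j jm; first by apply: eqyy'; lia.
rewrite !(determined_within_shift _ fr) /shift; have [jE|jN] := eqVneq (j + 1) (2 * m)%:Z.
  by apply: fr => d dr; apply: eqyy'; lia.
by apply: eqff'; lia.
Qed.

Hypothesis f_strong : strong_left_closing_radius f m.

Lemma strong_left_closing_inj (y y' : config S) :
  (forall j, m%:Z < j <= (2 * m)%:Z -> y j = y' j) ->
  (forall j, 0 <= j <= (2 * m)%:Z -> f y j = f y' j) -> y m%:Z = y' m%:Z.
Proof.
case: f_strong => m_gt0 _ strong eqyy' eqff'.
have [|a [_ a_uniq]] := strong (word y (m%:Z + 1) m) (word (f y) 1 (2 * m)) _ (f y 0).
  by exists y.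
apply: etrans (esym (a_uniq _ _)) (a_uniq _ _).
  by exists y; split; apply/word_cons.
exists y'; split; apply/word_cons; split.
- by [].
- by apply/eq_word => j jm; rewrite eqyy' //; lia.
- by rewrite eqff' //; lia.
- by apply/eq_word => j jm; rewrite eqff' //; lia.
Qed.

(** The shifted stair and the emitted letter contain the data from which strong left-closing
    recovers the dropped cell [m]. *)
Lemma stair_inj (y y' : config S) : stair (shift y) = stair (shift y') ->
  f y 0 = f y' 0 -> stair y = stair y' /\ y (3 * m)%:Z = y' (3 * m)%:Z.
Proof.
move=> /eq_stair[]; rewrite !(determined_within_shift _ fr) /shift => eqyy' eqff' eq0.
have {}eqyy' j : m%:Z < j <= (3 * m)%:Z -> y j = y' j.
  by have := eqyy' (j - 1); rewrite subrK => eqj jm; apply: eqj; lia.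
have {}eqff' j : 0 <= j <= (2 * m)%:Z -> f y j = f y' j.
  have [-> //|jN jm] := eqVneq j 0.
  by have := eqff' (j - 1); rewrite subrK; apply; lia.
have eqm : y m%:Z = y' m%:Z.
  by apply: strong_left_closing_inj eqff' => j jm; apply: eqyy'; lia.
split; last by apply: eqyy'; lia.
apply/eq_stair; split=> j jm; last by apply: eqff'; lia.
by have [->//|jN] := eqVneq j m%:Z; apply: eqyy'; lia.
Qed.

Lemma strong_left_closing_slider (S_nonempty : (0 < #|S|)%N) :
  (#|Psi f m| %| #|S| ^ (3 * m))%N -> slider f.
Proof.
case/dvdnP=> K cardK.
have K_gt0 : (0 < K)%N.
  by have := expn_gt0 #|S| (3 * m); rewrite cardK S_nonempty muln_gt0 => /andP[].
have /choice[wit witP] (pa : {p | p \in Psi f m} * S) :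
    exists y, stair y = pa.1 /\ y (3 * m)%:Z = pa.2 by exact: stair_extend.
(* The index below [K] is carried along unchanged and brings the number of states to |S|^(3m). *)
pose Q : finType := ({p | p \in Psi f m} * 'I_K)%type.
pose T (qa : Q * S) : S * Q :=
  let y := wit (qa.1.1, qa.2) in (f y 0, (stair (shift y), qa.1.2)).
have TE y c : T ((stair y, c), y (3 * m)%:Z) = (f y 0, (stair (shift y), c)).
  rewrite /T; have [/= eqs eqy] := witP (stair y, y (3 * m)%:Z).
  rewrite (stair_shift eqs eqy); congr pair.
  by have [_ /(_ 0)] := (eq_stair _ _).1 eqs; apply; lia.
apply: (@transducer_slider S Q (3 * m) T).
- move=> [[p c] a] [[p' c'] a'] /pair_equal_spec[eqf /pair_equal_spec[eqs /= ->]].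
  have [pE aE] := witP (p, a); have [p'E a'E] := witP (p', a').
  by have := stair_inj eqs eqf; rewrite pE p'E aE a'E => -[/= -> ->].
- by rewrite card_prod card_ord card_sig cardK mulnC; congr (_ * _)%N; apply: eq_card => p; rewrite inE.
move=> y z; split=> [[rho rhoR]|<-]; last first.
  exists (fun j => (stair (fun i => y (i + j)), Ordinal K_gt0)) => j.
  have := TE (fun i => y (i + j)) (Ordinal K_gt0); rewrite [_ + j]addrC => ->.
  congr pair; last first.
    by congr pair; congr stair; apply/funext => i; rewrite /shift; congr y; lia.
  by apply: fr => d _; congr y; lia.
(* The run yields overlapping local configurations: up to translation by [j], [x j] agrees with [y]
   on [m, 3m] and [f (x j)] with [z] on [0, 2m). *)
pose x j := wit ((rho j).1, y (j + (3 * m)%:Z)).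
have xP j : stair (x j) = (rho j).1 /\ x j (3 * m)%:Z = y (j + (3 * m)%:Z).
  exact: witP.
have xS j : z j = f (x j) 0 /\ stair (shift (x j)) = stair (x (j + 1)).
  by have [-> _] := xP (j + 1); have := rhoR j; by rewrite /T => /pair_equal_spec[<- <-].
have xy l j : (l <= 2 * m)%N -> x j ((3 * m)%:Z - l%:Z) = y (j + (3 * m)%:Z - l%:Z).
  elim: l j => [|l IHl] j lm; first by rewrite !subr0; case: (xP j).
  have [_ /eq_stair[eqx _]] := xS (j - 1).
  rewrite subrK in eqx; rewrite -eqx; last lia.
  rewrite /shift (_ : _ + 1 = (3 * m)%:Z - l%:Z); last lia.
  by rewrite IHl; [congr y; lia | lia].
have fxz l j : (l < 2 * m)%N -> f (x j) l%:Z = z (j + l%:Z).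
  elim: l j => [|l IHl] j lm; first by rewrite addr0; case: (xS j).
  have [_ /eq_stair[_ eqf]] := xS j.
  have := eqf l%:Z; rewrite (determined_within_shift _ fr) /shift IHl; last lia.
  rewrite (_ : l%:Z + 1 = l.+1%:Z); last lia.
  by move=> ->; [congr z; lia | lia].
(* Cell [m + r] lies in [0, 2m), and its neighborhood [m, m + 2r] lies where [x j] copies [y]. *)
apply/funext => i; pose j := i - (m + r)%:Z.
rewrite (_ : i = j + (m + r)%:Z); last by rewrite /j; lia.
rewrite -fxz; last lia.
apply: fr => d dr; have := xy (absz ((3 * m)%:Z - ((m + r)%:Z + d))%R) j.
rewrite (_ : (3 * m)%:Z - (absz ((3 * m)%:Z - ((m + r)%:Z + d))%R)%:Z = (m + r)%:Z + d); last lia.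
by move=> ->; [congr y; lia | lia].
Qed.

End Stairs.

(** * Growth of the number of stairs *)

Section StairGrowth.
Variables (S : finType) (f : config S -> config S) (m r : nat).
Hypotheses (r_gt0 : (0 < r)%N) (fr : determined_within f r) (rm : (2 * r <= m)%N).
Hypothesis f_strong : strong_left_closing_radius f m.

Lemma strong_left_closing_surj (y : config S) (p : int) (b : S) :
  exists y', [/\ forall j, p + m%:Z < j -> y' j = y j,
    forall j, p < j -> f y' j = f y j & f y' p = b].
Proof.
have [m_gt0 _ strong] := f_strong; pose y0 : config S := fun j => y (j + p).
have fy0 j : f y0 j = f y (j + p) by apply: fr => d _; rewrite /y0; congr y; lia.
have [|a [[x []]]] := strong (word y0 (m%:Z + 1) m) (word (f y0) 1 (2 * m)) _ b.
  by exists y0.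
move=> /word_cons[_ /eq_word xy0] /word_cons[fx0 /eq_word fxy0] _.
have {}xy0 j : m%:Z < j <= (2 * m)%:Z -> x j = y0 j.
  move=> jm; have := xy0 (absz (j - (m%:Z + 1))%R).
  by rewrite (_ : m%:Z + 1 + (absz (j - (m%:Z + 1))%R)%:Z = j); [apply | ]; lia.
have {}fxy0 j : 0 < j <= (2 * m)%:Z -> f x j = f y0 j.
  move=> jm; have := fxy0 (absz (j - 1)%R).
  have -> : 0 + 1 + (absz (j - 1)%R)%:Z = j by lia.
  by apply; lia.
(* Glue [x] on the left to [y0] on the right. They agree on (m, 2m], of length at least [2r], so
   every neighborhood sees only one of them. *)
pose y1 : config S := fun j => if j <= (2 * m)%:Z then x j else y0 j.
have fy1x j : j <= (2 * m)%:Z - r%:Z -> f y1 j = f x j.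
  by move=> jm; apply: fr => d dr; rewrite /y1 ifT //; lia.
have fy1y0 j : 0 < j -> f y1 j = f y0 j.
  move=> j0; have [jm|mj] := lerP j ((2 * m)%:Z - r%:Z); first by rewrite fy1x ?fxy0 //; lia.
  by apply: fr => d dr; rewrite /y1; case: ifP => // jd; apply: xy0; lia.
pose y' : config S := fun j => y1 (j - p).
have fy' j : f y' j = f y1 (j - p) by apply: fr => d _; rewrite /y'; congr y1; lia.
exists y'; split=> [j pj|j pj|].
- rewrite /y' /y1; case: ifP => jm; last by rewrite /y0 subrK.
  by rewrite xy0 ?/y0 ?subrK //; lia.
- by rewrite fy' fy1y0 ?fy0 ?subrK //; lia.
- by rewrite fy' subrr fy1x //; lia.
Qed.

Lemma strong_left_closing_prepend (y : config S) (p : int) (z : int -> S) (n : nat) :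
  exists y', [/\ forall j, p + m%:Z <= j -> y' j = y j,
    forall j, p <= j -> f y' j = f y j &
    forall j, p - n%:Z <= j < p -> f y' j = z j].
Proof.
elim: n => [|n [y' [y'y fy'y fy'z]]]; first by exists y; split=> // j; lia.
have [y'' [y''y' fy''y' fy''z]] :=
  strong_left_closing_surj y' (p - n.+1%:Z) (z (p - n.+1%:Z)).
exists y''; split=> j jp.
- by rewrite y''y' ?y'y //; lia.
- by rewrite fy''y' ?fy'y //; lia.
- have [->//|jN] := eqVneq j (p - n.+1%:Z).
  by rewrite fy''y' ?fy'z //; lia.
Qed.

(** A stair of size [m + d] amounts to a stair of size [m] translated by [d], [d] free outputs on
    its left and [2d] free inputs on its right; the last [d] outputs are computed from the
    inputs. *)
Lemma card_Psi_add (d : nat) : (#|Psi f (m + d)| = #|Psi f m| * #|S| ^ (3 * d))%N.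
Proof.
have /choice[wit witP] := @stair_surj _ f (m + d).
pose core (y : config S) : config S := fun j => y (j + d%:Z).
have f_core y j : f (core y) j = f y (j + d%:Z).
  by apply: fr => e _; rewrite /core; congr y; lia.
pose g p := (stair f m (core (wit p)), word (f (wit p)) 0 d,
  word (wit p) ((3 * m)%:Z + d%:Z) (2 * d)).
have g_stair y y' : stair f (m + d) y = stair f (m + d) y' <->
    (stair f m (core y), word (f y) 0 d, word y ((3 * m)%:Z + d%:Z) (2 * d)) =
    (stair f m (core y'), word (f y') 0 d, word y' ((3 * m)%:Z + d%:Z) (2 * d)).
  split=> [/eq_stair[eqyy' eqff']|].
    congr (_, _, _).
    - by apply/eq_stair; split=> j jm; [apply: eqyy' | rewrite !f_core; apply: eqff']; lia.
    - by apply/eq_word => j jd; apply: eqff'; lia.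
    - by apply/eq_word => j jd; apply: eqyy'; lia.
  move=> /pair_equal_spec[/pair_equal_spec[/eq_stair[eqc eqfc] /eq_word eqf] /eq_word eqy].
  have {}eqyy' j : (m + d)%:Z <= j < (3 * (m + d))%:Z -> y j = y' j.
    move=> jm; have [j3|j3] := ltP j ((3 * m)%:Z + d%:Z).
      by have := eqc (j - d%:Z); rewrite /core subrK; apply; lia.
    have := eqy (absz (j - ((3 * m)%:Z + d%:Z))%R).
    by rewrite (_ : _ + (absz _)%:Z = j); [apply | ]; lia.
  apply/eq_stair; split=> // j jm.
  have [jd|dj] := ltP j d%:Z.
    by have := eqf (absz j); rewrite (_ : 0 + (absz j)%:Z = j); [apply | ]; lia.
  have [j2|j2] := ltP j ((2 * m)%:Z + d%:Z).
    by have := eqfc (j - d%:Z); rewrite !f_core subrK; apply; lia.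
  by apply: fr => e er; apply: eqyy'; lia.
have g_inj : injective g by move=> p p' /g_stair; rewrite !witP.
have g_surj t : exists p, t = g p.
  case: t => -[p u] v; have [y0 y0p] := stair_surj p.
  have [s0 _] : exists s : S, True by exists (y0 0).
  pose y1 : config S := fun j =>
    if j < (3 * m)%:Z + d%:Z then y0 (j - d%:Z)
    else nth s0 v (absz (j - ((3 * m)%:Z + d%:Z))%R).
  (* Forcing the outputs on [0, d) changes inputs only left of cell [m + d], outside the core
     stair. *)
  have [y [yy1 fyy1 fyu]] := strong_left_closing_prepend y1 d%:Z (fun j => nth s0 u (absz j)) d.
  have gE : (stair f m (core y), word (f y) 0 d, word y ((3 * m)%:Z + d%:Z) (2 * d)) = (p, u, v).
    congr (_, _, _).
    - rewrite -y0p; apply/eq_stair; split=> j jm.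
        by rewrite /core yy1 /y1 ?ifT ?addrK //; lia.
      rewrite f_core fyy1; last lia.
      by apply: fr => e er; rewrite /y1 ifT; [congr y0; lia | lia].
    - apply: eq_from_tnth => j; rewrite tnth_mktuple fyu ?(tnth_nth s0); last by have := ltn_ord j; lia.
      by congr nth; lia.
    - apply: eq_from_tnth => j; rewrite tnth_mktuple yy1; last by have := ltn_ord j; lia.
      by rewrite /y1 ifF ?(tnth_nth s0); [congr nth; lia | by have := ltn_ord j; lia].
  exists (stair f (m + d) y); rewrite -gE; apply/g_stair.
  by rewrite witP.
have [h gK hK] : bijective g.
  have /choice[h hP] := g_surj.
  by exists h => [p|t]; [apply: g_inj; rewrite -hP | rewrite -hP].
have := bij_eq_card (Bijective gK hK).
rewrite !card_prod !card_tuple !card_sig -mulnA -expnD => cardE.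
by rewrite (_ : 3 * d = d + 2 * d)%N; [exact: cardE | lia].
Qed.

End StairGrowth.

(** * Cellular automata computed by transducers *)

Section TransducerCA.
Variables (S Q : finType) (T : Q * S -> S * Q) (U : S * Q -> Q * S).
Hypotheses (TK : cancel T U) (UK : cancel U T).
Variables (k : nat) (f : config S -> config S).
Hypothesis fP : forall y z : config S,
  (exists rho, run T rho (fun i => y (i + k%:Z)) z) <-> f y = z.

Lemma run_total (y : int -> S) : exists rho z, run T rho y z.
Proof.
have [rho rhoR] := (fP (fun i => y (i - k%:Z)) _).2 erefl.
exists rho, (f (fun i => y (i - k%:Z))) => i.
by have := rhoR i; rewrite addrK.
Qed.

Lemma run_functional : functional_runs T.
Proof.
move=> rho y z rho' y' z' runR runR' eqyy' j.
have fE rho1 y1 z1 : run T rho1 y1 z1 -> f (fun i => y1 (i - k%:Z)) = z1.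
  by move=> run1; apply/fP; exists rho1 => i; rewrite addrK.
by rewrite -(fE _ _ _ runR) -(fE _ _ _ runR'); congr f; apply/funext => i.
Qed.

Variable n : nat.
Hypothesis memory : forall q q' (u : seq S) (a : S), (n <= size u)%N ->
  (T (foldl (next T) q u, a)).1 = (T (foldl (next T) q' u, a)).1.

Local Notation states y i := (reach T (window n (fun j : int => y (j + k%:Z)) i)).

Lemma states_eq (y y' : config S) (i i' : int) :
  (forall d, k%:Z - n%:Z <= d < k%:Z -> y (i + d) = y' (i' + d)) ->
  states y i = states y' i'.
Proof.
move=> eqyy'; congr (reach _ _); apply: (@eq_from_nth _ (y 0)); rewrite ?size_mkseq // => l ln.
rewrite !nth_mkseq //; have := eqyy' (l%:Z - n%:Z + k%:Z).
by rewrite !addrA ![_ + l%:Z - _]addrAC; apply; lia.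
Qed.

Lemma states_run (y : config S) (i : int) (q : Q) :
  q \in states y i <-> exists rho, run T rho (fun j => y (j + k%:Z)) (f y) /\ rho i = q.
Proof.
split=> [/(reach_run TK UK memory run_total)[rho [z [rhoR rhoi]]]|[rho [rhoR <-]]].
  exists rho; split=> //; suff -> : f y = z by [].
  by apply/fP; exists rho.
exact: run_reach rhoR.
Qed.

(** The state is among those reached by the [n] letters before cell [i + k], and these all emit the
    same letter on reading that cell. *)
Lemma transducer_output (x x' : config S) (i i' : int) :
  (forall d, k%:Z - n%:Z <= d <= k%:Z -> x (i + d) = x' (i' + d)) -> f x i = f x' i'.
Proof.
move=> eqxx'.
have [rho rhoR] := (fP x _).2 erefl; have [rho' rhoR'] := (fP x' _).2 erefl.
have := rhoR i; have := rhoR' i'; rewrite eqxx'; last lia.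
move=> T'E TE; have := run_reach n i' rhoR'; rewrite -(@states_eq x x' i); last first.
  by move=> d dk; apply: eqxx'; lia.
move=> /(reach_output memory (x' (i' + k%:Z)) _ (run_reach n i rhoR)).
by rewrite TE T'E size_mkseq; apply.
Qed.

Lemma transducer_determined_within : determined_within f (n + k)%N.
Proof. by move=> x x' i i' eqxx'; apply: transducer_output => d dk; apply: eqxx'; lia. Qed.

(** Equal windows give equal sets of states, so some run on [y'] shares its state at time [i] with a
    run on [y], and equal outputs are traced back from there. This bounded form serves both
    left-closing and the uniqueness in its strong version. *)
Lemma transducer_closing (y y' : config S) (i : int) (N : nat) :
  (forall j, i + k%:Z - n%:Z <= j < i + k%:Z -> y j = y' j) ->
  (forall j, i - N%:Z <= j < i -> f y j = f y' j) ->
  forall j, i + k%:Z - N%:Z <= j < i + k%:Z -> y j = y' j.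
Proof.
move=> eqyy' eqff' j jN; have [rho rhoR] := (fP y _).2 erefl.
have := run_reach n i rhoR; rewrite (@states_eq y y' i i); last first.
  by move=> d dk; apply: eqyy'; lia.
move=> /states_run[rho' [rhoR' rhoi]].
have [_ eqyy] := run_backward TK rhoR rhoR' (esym rhoi) eqff'.
by have := eqyy (j - k%:Z); rewrite subrK; apply; lia.
Qed.

(** Keep the state at time [p] and the future, and run backwards from new outputs. This gives the
    existence half of strong left-closing. *)
Lemma transducer_reset (y : config S) (z : int -> S) (p : int) :
  exists y', [/\ forall j, p + k%:Z <= j -> y' j = y j,
    forall j, p <= j -> f y' j = f y j & forall j, j < p -> f y' j = z j].
Proof.
have [rho rhoR] := (fP y _).2 erefl.
have [rho' [y' [z' [rhoR' rhop y'y z'z]]]] :=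
  run_through UK (rho p) p (fun j => y (j + k%:Z)) z.
pose x : config S := fun j => y' (j - k%:Z).
have fx : f x = z' by apply/fP; exists rho' => i; rewrite /x addrK.
exists x; split=> [j pj|j pj|j jp]; last by rewrite fx z'z.
  by rewrite /x y'y ?subrK //; lia.
have [|_ eqz] := run_forward rhoR' rhoR rhop (n := absz (j + 1 - p)%R).
  by move=> l lp; apply: y'y; lia.
by rewrite fx eqz //; lia.
Qed.

Lemma transducer_left_closing : left_closing f.
Proof.
move=> y y' neqyy' [i eqyy'] eqff'; apply: neqyy'; apply/funext => j.
have [ij|ji] := lerP i j; first exact: eqyy'.
apply: (@transducer_closing y y' (i + n%:Z) (absz (i + n%:Z + k%:Z - j)%R)).
- by move=> l li; apply: eqyy'; lia.
- by rewrite eqff'.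
- by lia.
Qed.

Lemma transducer_strong : strong_left_closing_radius f (2 * (n + k).+1).
Proof.
set m := (2 * (n + k).+1)%N; split; first by rewrite muln_gt0.
  exists (n + k).+1; split=> //; apply/neighborhood_radiusP => x x' i i' eqxx'.
  by apply: transducer_determined_within => d dr; apply: eqxx'; lia.
move=> s t [x [xs fxt]] b.
have [y [yx fyx fyb]] := transducer_reset x (fun=> b) 1.
have y_cons x' a : x' = y /\ a = y m%:Z -> word x' m%:Z m.+1 = [tuple of a :: s] /\
    word (f x') 0 (2 * m).+1 = [tuple of b :: t].
  move=> [-> ->]; split; apply/word_cons; split=> //.
  - by rewrite -xs; apply/eq_word => j jm; apply: yx; lia.
  - by apply: fyb.
  - by rewrite -fxt; apply/eq_word => j jm; rewrite fyx //; lia.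
exists (y m%:Z); split=> [|a [x' [/word_cons[<- x's] /word_cons[fx'b fx't]]]].
  by exists y; apply: y_cons.
have {}x's : word x' (m%:Z + 1) m = word y (m%:Z + 1) m.
  by rewrite x's; have [/word_cons[]] := y_cons _ _ (conj erefl erefl).
have {}fx't : word (f x') (0 + 1) (2 * m) = word (f y) (0 + 1) (2 * m).
  by rewrite fx't; have [_ /word_cons[]] := y_cons _ _ (conj erefl erefl).
move: x's fx't => /eq_word x's /eq_word fx't.
(* The window (2m - n, 2m] lies in (m, 2m], where the inputs agree; tracing back the outputs on [0,
   2m + 1 - k) reaches down to cell [k], hence past [m]. *)
apply: (@transducer_closing y x' ((2 * m).+1%:Z - k%:Z) ((2 * m).+1 - k)%N); last lia.
- move=> j jm; have := x's (absz (j - (m%:Z + 1))%R).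
  have -> : m%:Z + 1 + (absz (j - (m%:Z + 1))%R)%:Z = j by lia.
  by move=> ->//; lia.
- move=> j jm; have [->|j0] := eqVneq j 0; first by rewrite fx'b fyb.
  have := fx't (absz (j - 1)%R).
  have -> : 0 + 1 + (absz (j - 1)%R)%:Z = j by lia.
  by move=> ->//; lia.
Qed.

Hypothesis cardQ : #|Q| = (#|S| ^ k)%N.

(* Counts the runs across [0, 3m) twice: as words of length 3m, made of the outputs
   before time 3m - k and the state at that time, and as pairs of a stair and
   one of the c states it leads to. *)
Lemma card_Psi_transducer (m : nat) : (0 < #|S|)%N -> (n + k <= m)%N ->
  exists c, (c * #|Psi f m| = #|S| ^ (3 * m))%N.
Proof.
move=> /card_gt0P[s0 _] nkm; pose i0 := (3 * m - k)%N.
pose c := #|reach T (nseq n s0)|; exists c.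
have card_states y i : #|states y i| = c.
  by apply: (card_reach TK memory); rewrite ?size_mkseq ?size_nseq.
(* The states at time [i0] are those reached on the cells [3m - n, 3m), which end the input part of
   the stair. *)
pose tail (p : {p | p \in Psi f m}) := reach T (drop (2 * m - n) (val p).1).
have tailE y : tail (stair f m y) = states y i0%:Z.
  congr (reach _ _); apply: (@eq_from_nth _ s0) => [|l ln].
    by rewrite size_drop size_tuple size_mkseq; lia.
  rewrite size_drop size_tuple in ln.
  rewrite nth_drop nth_word ?nth_mkseq; [congr y; rewrite /i0 | |]; lia.
have /choice[wit witP] := @stair_surj _ f m.
have /choice[cut cutP] (zq : i0.-tuple S * Q) : exists y : config S,
    zq.2 \in states y i0%:Z /\ word (f y) 0 i0 = zq.1.
  have [rho [y' [z' [rhoR rhoi _ z'z]]]] :=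
    run_through UK zq.2 i0%:Z (fun=> s0) (fun j => nth s0 zq.1 (absz j)).
  pose y : config S := fun j => y' (j - k%:Z).
  have fy : f y = z' by apply/fP; exists rho => i; rewrite /y addrK.
  exists y; split.
    by apply/states_run; exists rho; split=> // i; rewrite fy /y addrK.
  apply: eq_from_tnth => j; rewrite tnth_mktuple fy z'z; last by have := ltn_ord j; lia.
  by rewrite (tnth_nth s0); congr nth; lia.
pose h zq := (stair f m (cut zq), zq.2).
have h_inj : injective h.
  move=> [z q] [z' q'] /pair_equal_spec[/eq_stair[eqy eqf] /= eqq].
  have [_ zE] := cutP (z, q); have [_ z'E] := cutP (z', q').
  rewrite /= in zE z'E; rewrite -zE -z'E -eqq; congr pair.
  rewrite {}eqq {zE z'E} in eqy eqf *.
  (* Outputs from [2m] on are not in the stair but, as [n <= m], are computed from its inputs. *)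
  apply/eq_word => l li; have [lm|ml] := ltnP l (2 * m); first by apply: eqf; lia.
  by apply: transducer_output => d dk; apply: eqy; rewrite /i0 in li; lia.
have h_img p q : (q \in tail p) = ((p, q) \in [set h zq | zq in [set: _]]).
  apply/idP/imsetP => [|[zq _ /pair_equal_spec[-> ->]]]; last first.
    by rewrite tailE; have [] := cutP zq.
  rewrite -(witP p) tailE => /states_run[rho [rhoR rhoi]].
  exists (word (f (wit p)) 0 i0, q); first by rewrite inE.
  have [] := cutP (word (f (wit p)) 0 i0, q) => /states_run[rho' [rhoR' rhoi']] /eq_word eqff'.
  have {}eqff' j : 0 <= j < i0%:Z -> f (cut (word (f (wit p)) 0 i0, q)) j = f (wit p) j.
    by move=> ji; have := eqff' (absz j); rewrite (_ : 0 + (absz j)%:Z = j); [apply|]; lia.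
  rewrite /= in rhoi'; rewrite -rhoi in rhoi'.
  (* A common state at [i0] and common outputs on [0, i0) force common inputs on [k, 3m), which
     contains [m, 3m). *)
  have [|_ eqyy'] := run_backward TK rhoR' rhoR rhoi' (n := i0).
    by move=> j ji; apply: eqff'; lia.
  congr pair; apply/esym/eq_stair; split=> j jm; last by apply: eqff'; rewrite /i0; lia.
  by have := eqyy' (j - k%:Z); rewrite subrK; apply; rewrite /i0; lia.
have card_img : #|[set h zq | zq in [set: _]]| = (\sum_p #|tail p|)%N.
  rewrite -sum1_card; under [RHS]eq_bigr do rewrite -sum1_card.
  by rewrite pair_big_dep; apply: eq_bigl => -[p q]; rewrite /= h_img.
have := card_imset [set: _] h_inj.
rewrite card_img cardsT card_prod card_tuple cardQ -expnD subnK; last lia.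
move=> <-; rewrite (eq_bigr (fun=> c)) => [|p _]; last by rewrite -(witP p) tailE card_states.
by rewrite sum_nat_const card_sig mulnC.
Qed.

End TransducerCA.

Theorem theorem19 (S : finType) (S_nonempty : (0 < #|S|)%N)
  (f : config S -> config S) :
  slider f <->
  [/\ cellular_automaton f, left_closing f &
      exists m : nat, smallest_strong_left_closing_radius f m /\
                      (#|Psi f m| %| #|S| ^ (3 * m))%N].
Proof.
split=> [|[_ _ [m [[f_strong _] dvd_Psi]]]]; last first.
  have [_ [r [r_gt0 /neighborhood_radiusP fr rm]] _] := f_strong.
  exact: strong_left_closing_slider r_gt0 fr rm f_strong S_nonempty dvd_Psi.
case=> -[|k] [chi [xi [// _ chiK xiK sliderP]]].
pose T := block_step chi; pose U (p : S * k.-tuple S) := split_last (xi (join_head p)).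
have TK : cancel T U by move=> p; rewrite /U /T /block_step split_headK chiK join_lastK.
have UK : cancel U T by move=> p; rewrite /U /T /block_step split_lastK xiK join_headK.
have fP y z : (exists rho, run T rho (fun i => y (i + k%:Z)) z) <-> f y = z.
  by rewrite -sliderP; apply: iff_sym; exact: slider_relation_run.
have [n memory] := functional_runs_memory (run_functional fP).
have fr := transducer_determined_within fP memory.
have strong_ex : exists m, `[< strong_left_closing_radius f m >].
  by exists (2 * (n + k).+1)%N; apply/asboolP; exact: transducer_strong memory.
split.
- by split; [exact: determined_within_continuous fr | move=> x; exact: determined_within_shift fr].
- exact: transducer_left_closing memory.
case: (ex_minnP strong_ex) => m /asboolP f_strong m_min; exists m; split.
  by split=> // m' f_strong'; apply: m_min; apply/asboolP.
have [_ [r [r_gt0 /neighborhood_radiusP f_r rm]] _] := f_strong.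
(* Count at size [m + (n + k)], which is large enough, then cancel the factor |S|^(3(n + k)) gained
   over size [m]. *)
have [c] := card_Psi_transducer TK UK fP memory (card_tuple _ _) S_nonempty
  (leq_addl m (n + k)).
rewrite (card_Psi_add r_gt0 f_r rm f_strong) (mulnDr 3 m) expnD mulnA => /eqP.
rewrite eqn_pmul2r ?expn_gt0 ?S_nonempty // => /eqP <-.
exact: dvdn_mull.
Qed.
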